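(* Let $G$ be a locally compact Abelian group with dual group $\widehat G$ and Haar measure $\mu$, and assume $\mu(G)<\infty$. Let $1<p<\infty$ and $\theta\ge 0$. Then every closed set $E\subset\widehat G$ that is a Ditkin set for the generalized grand Lebesgue space $L^{p),\theta}(G)$ is a Ditkin set for $L^1(G)$.
   Context: The generalized grand Lebesgue space $L^{p),\theta}(G)$ consists of measurable $f$ on $G$ with $\|f\|_{p),\theta}=\sup_{0<\varepsilon\le p-1}\varepsilon^{\theta/(p-\varepsilon)}\left(\int_G|f|^{p-\varepsilon}\,d\mu\right)^{1/(p-\varepsilon)}<\infty$; it is a Banach space, and (as $\mu(G)<\infty$) it is contained in $L^1(G)$ and is a Banach ideal in $L^1(G)$ under convolution. For a Banach space $X\subset L^1(G)$ of this kind (a Banach ideal in $L^1(G)$, i.e. continuously embedded in $L^1(G)$ with $g*f\in X$ for $g\in L^1(G)$, $f\in X$), a closed set $E\subset\widehat G$ is a Ditkin set for $X$ if for every $f\in X$ whose Fourier transform $\hat f$ vanishes on $E$ and every $\varepsilon>0$ there is $F\in X$ such that $\hat F$ vanishes on some neighbourhood of $E$ and $\|f-f*F\|_X<\varepsilon$ (with $X=L^1(G)$ this defines Ditkin sets for $L^1(G)$). *)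

(* Defs.v *)
From HB Require Import structures.
From mathcomp Require Import all_boot all_order all_algebra.
From mathcomp Require Import all_classical all_reals all_analysis.
From mathcomp Require Import complex.

Set Implicit Arguments.
Unset Strict Implicit.
Unset Printing Implicit Defensive.

Import Order.TTheory GRing.Theory Num.Theory.
Local Open Scope classical_set_scope.
Local Open Scope ring_scope.

Definition ptd (G : topologicalZmodType) : Type := G.
HB.instance Definition _ (G : topologicalZmodType) := Choice.copy (ptd G) G.
HB.instance Definition _ (G : topologicalZmodType) :=
  isPointed.Build (ptd G) (0 : G).

Notation Borel G := (@g_sigma_algebraType (ptd G) (@open G)).

Section Defs.
Variables (R : realType) (G : topologicalZmodType).

Local Notation C := R[i].

Definition cabs (z : C) : R :=
  Num.sqrt (complex.Re z ^+ 2 + complex.Im z ^+ 2).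

Definition cconj (z : C) : C := Complex (complex.Re z) (- complex.Im z).

Definition haar_measure (mu : {measure set (Borel G) -> \bar R}) : Prop :=
  [/\ (forall (A : set (Borel G)) (a : G), measurable A ->
         mu [set a + x | x in A] = mu A),
      (forall K : set G, compact K -> (mu K < +oo)%E),
      (forall U : set G, open U -> U !=set0 -> (0 < mu U)%E),
      (forall A : set (Borel G), measurable A ->
         mu A = ereal_inf [set mu U | U in [set U : set G | open U /\ A `<=` U]]) &
      (forall U : set G, open U ->
         mu U = ereal_sup [set mu K | K in [set K : set G | compact K /\ K `<=` U]])].

Definition cmeasurable (f : G -> C) : Prop :=
  measurable_fun [set: Borel G] (fun x : Borel G => complex.Re (f x)) /\
  measurable_fun [set: Borel G] (fun x : Borel G => complex.Im (f x)).

Variable mu : {measure set (Borel G) -> \bar R}.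

(** integral of a complex valued function (meaningful for integrable f) *)
Definition cint (f : G -> C) : C :=
  Complex (fine (\int[mu]_(x in [set: Borel G]) (complex.Re (f x))%:E))
          (fine (\int[mu]_(x in [set: Borel G]) (complex.Im (f x))%:E)).

Definition conv (f g : G -> C) : G -> C :=
  fun x => cint (fun y => f y * g (x - y)).

Definition character (chi : G -> C) : Prop :=
  [/\ (forall x y, chi (x + y) = chi x * chi y),
      (forall x, cabs (chi x) = 1) &
      (forall x (e : R), 0 < e -> \forall y \near x, cabs (chi y - chi x) < e)].

(** open sets of \hat G for its (compact-open) topology, i.e. the topology of
    uniform convergence on compact subsets of G *)
Definition dual_open (U : set (G -> C)) : Prop :=
  U `<=` character /\
  forall chi, U chi -> exists K : set G, exists e : R,
    [/\ compact K, 0 < e &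
     forall eta, character eta ->
       (forall x, K x -> cabs (eta x - chi x) < e) -> U eta].

Definition dual_closed (E : set (G -> C)) : Prop :=
  E `<=` character /\ dual_open (character `\` E).

Definition fourier (f : G -> C) (chi : G -> C) : C :=
  cint (fun x => f x * cconj (chi x)).

Definition L1norm (f : G -> C) : \bar R :=
  (\int[mu]_(x in [set: Borel G]) (cabs (f x))%:E)%E.

Definition inL1 (f : G -> C) : Prop := cmeasurable f /\ (L1norm f < +oo)%E.

Definition grand_norm (p theta : R) (f : G -> C) : \bar R :=
  ereal_sup [set ((eps `^ (theta / (p - eps)))%:E *
                  poweR (\int[mu]_(x in [set: Borel G]) (cabs (f x) `^ (p - eps))%:E)
                        (p - eps)^-1)%E
            | eps in `]0, p - 1]].

Definition in_grand (p theta : R) (f : G -> C) : Prop :=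
  cmeasurable f /\ (grand_norm p theta f < +oo)%E.

Definition ditkin_set (inX : (G -> C) -> Prop) (normX : (G -> C) -> \bar R)
    (E : set (G -> C)) : Prop :=
  forall f, inX f -> (forall chi, E chi -> fourier f chi = 0) ->
  forall eps : R, 0 < eps ->
  exists F, [/\ inX F,
     (exists U, [/\ dual_open U, E `<=` U & forall chi, U chi -> fourier F chi = 0]) &
     (normX (fun x => (f x - conv f F x)%R) < eps%:E)%E].

End Defs.

(* Main.v *)
(* A locally compact group of finite Haar measure is compact, so convolution
   with a continuous kernel is well behaved: [(x, y) |-> u (x - y)] is a uniform
   limit of Borel step functions, and Fubini's theorem on the product sigma-algebra
   applies to [a y * u (x - y) * b x] for integrable [a] and [b].

   Given [f] in [L1] with transform vanishing on [E], choose a continuous bump [u]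
   with [f * u] close to [f] in [L1].  The continuous function [h = f * u] lies in
   the grand Lebesgue space and its transform vanishes on [E], so the hypothesis
   gives [F] with [h - h * F] small in the grand norm, hence in [L1], since the
   term [eps = p - 1] of the grand norm is a multiple of the [L1] norm.  As
   [h * F = f * (F * u)], the function [F * u] is the one required for [f]. *)

Require Import Defs.
From HB Require Import structures.
From mathcomp Require Import all_boot all_order all_algebra.
From mathcomp Require Import all_classical all_reals all_analysis.
From mathcomp Require Import measurable_realfun complex.
From mathcomp Require Import ring lra.

Set Implicit Arguments.
Unset Strict Implicit.
Unset Printing Implicit Defensive.

Import Order.TTheory GRing.Theory Num.Theory.
Import numFieldNormedType.Exports.
Local Open Scope classical_set_scope.
Local Open Scope ring_scope.

(** * Borel measurability and uniform continuity on a topological group *)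

Section BorelGroup.
Context {R : realType} {G : topologicalZmodType}.

Lemma open_measurable_Borel {U : set G} :
  open U -> measurable (U : set (Borel G)).
Proof. by move=> oU; exact: sub_sigma_algebra. Qed.

Lemma compact_measurable_Borel (HG : hausdorff_space G) (K : set G) :
  compact K -> measurable (K : set (Borel G)).
Proof.
move=> cK; have cl : closed K by exact: compact_closed.
rewrite -[K]setCK; apply: measurableC; apply: open_measurable_Borel.
exact: closed_openC.
Qed.

Lemma continuous_measurable_Borel (f : G -> R) :
  continuous f -> measurable_fun [set: Borel G] (f : Borel G -> R).
Proof.
move=> /continuousP cf; apply: (measurability _ (RGenOpens.measurableE R)).
move=> _ [_ [a [b ->] <-]]; rewrite setTI.
by apply: open_measurable_Borel; exact/cf/interval_open.
Qed.

Lemma continuous_measurable_endo (phi : G -> G) : continuous phi ->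
  measurable_fun [set: Borel G] (phi : Borel G -> Borel G).
Proof.
move=> /continuousP cphi.
apply: (@measurability _ _ (Borel G) (Borel G) setT phi (@open G) erefl).
by move=> _ [U oU <-]; rewrite setTI; apply: open_measurable_Borel; exact: cphi.
Qed.

Lemma continuous_addl (a : G) : continuous (fun x : G => a + x).
Proof.
move=> x; apply: (@continuous_comp G (G * G)%type G (fun x => (a, x))
  (fun z => z.1 + z.2)); last exact: add_continuous.
by apply: cvg_pair; [exact: cvg_cst|exact: cvg_id].
Qed.
Arguments continuous_addl : clear implicits.

Lemma continuous_subl (a : G) : continuous (fun x : G => a - x).
Proof.
move=> x; apply: (@continuous_comp G G G -%R (fun z => a + z)).
  exact: opp_continuous.
exact: continuous_addl.
Qed.
Arguments continuous_subl : clear implicits.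

Lemma continuous_subr (a : G) : continuous (fun x : G => x - a).
Proof.
by move=> x; under eq_fun do rewrite addrC; exact: continuous_addl.
Qed.
Arguments continuous_subr : clear implicits.

Section Compact.
Hypothesis cG : compact [set: G].

Lemma continuous_bounded (h : G -> R) : continuous h ->
  exists2 M, 0 < M & forall x, `|h x| <= M.
Proof.
move=> ch; have := @continuous_compact _ _ h _ (continuous_subspaceT ch) cG.
move=> /compact_bounded[M [_ hM]]; exists (`|M| + 1) => [|x].
  by rewrite ltr_pwDr.
by apply: (hM (`|M| + 1)) => //; rewrite (le_lt_trans (ler_norm M))// ltrDl.
Qed.

(** The increment [h (x + v) - h x] is jointly continuous and vanishes at every [(x, 0)].
    Compactness of [G] turns the resulting local neighbourhoods of [(x, 0)] into one neighbourhood
    of [0] valid for all [x]. *)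
Lemma uniform_continuity (h : G -> R) (e : R) : continuous h -> 0 < e ->
  \forall v \near (0 : G), forall x, `|h (x + v) - h x| < e.
Proof.
move=> ch e0.
have /compact_near_coveringP cov := cG.
suff : \forall v \near (0 : G),
    [set: G] `<=` (fun x => `|h (x + v) - h x| < e).
  by apply: filterS => v hv x; exact: hv.
apply: cov => x _.
pose k := fun z : G * G => h (z.1 + z.2) - h z.1.
have ck : {for (x, 0), continuous k}.
  apply: (@continuousB _ _ _ (fun z : G * G => h (z.1 + z.2))
     (fun z : G * G => h z.1)).
    apply: (@continuous_comp _ _ _ (fun z : G * G => z.1 + z.2) h).
      exact: add_continuous.
    exact: ch.
  by apply: (@continuous_comp _ _ _ (@fst G G) h); [exact: cvg_fst|exact: ch].
have : \forall z \near (x, 0 : G), `|k z - k (x, 0)| < e.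
  by move/cvgr_dist_lt : ck => /(_ _ e0); apply: filterS => z; rewrite distrC.
by rewrite /k /= addr0 subrr; apply: filterS => z /=; rewrite subr0.
Qed.

(* The compactness of [G] is used through near coverings, because the library
   states the open cover property for pointed spaces only. *)
Lemma finite_translate_cover (V : set G) : open V -> V 0 ->
  exists D : seq G, forall z, exists2 y, y \in D & V (z - y).
Proof.
move=> oV V0.
(* The lists containing a given list generate a filter, and a property that holds near this filter
   holds for some list. *)
pose F := filter_from [set: seq G] (fun s => [set t : seq G | {subset s <= t}]).
have FF : Filter F.
  apply: filter_from_filter; first by exists nil.
  move=> s t _ _; exists (s ++ t) => // r /= str; split => z zs; apply: str.
    by rewrite mem_cat zs.
  by rewrite mem_cat zs orbT.
have /compact_near_coveringP cov := cG.
have [|s _ hs] := cov _ F (fun (t : seq G) z => exists2 y, y \in t & V (z - y)) FF.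
  move=> x _; exists ([set z | V (z - x)], [set t : seq G | x \in t]) => /=.
    split; last by exists [:: x] => // t /= xt; apply: xt; rewrite inE.
    apply: open_nbhs_nbhs; split; last by rewrite /= subrr.
    by have /continuousP := continuous_subr x; exact.
  by move=> [z t] /= [Vz xt]; exists x.
by exists s => z; exact: (hs s).
Qed.

(** [V] consists of the increments [v] that change [h] by less than [e] everywhere, and [x - y]
    arises from [x - z] by the increment [z - y]. Finitely many slices [h (x - y)] thus approximate
    the whole kernel. *)
Lemma finite_uniform_net (h : G -> R) (e : R) : continuous h -> 0 < e ->
  exists (V : set G) (D : seq G), [/\ open V,
    (forall z, exists2 y, y \in D & V (z - y)) &
    (forall y z, V (z - y) -> forall x, `|h (x - y) - h (x - z)| < e)].
Proof.
move=> ch e0.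
pose V := interior [set v : G | forall x, `|h (x + v) - h x| < e].
have oV : open V by exact: open_interior.
have V0 : V 0 by exact: uniform_continuity.
have hV : V `<=` [set v : G | forall x, `|h (x + v) - h x| < e].
  exact: interior_subset.
have [D hD] := finite_translate_cover oV V0.
exists V, D; split => //.
move=> y z /hV/(_ _) + x => /(_ (x - z)).
  by rewrite [x - z + _]addrA subrK.
Qed.

(** Open sets of [G * G] may fail to lie in the product of the Borel sigma-algebras, so continuity
    alone does not give measurability. Each superlevel set is instead a countable union of finite
    unions of open rectangles. *)
Lemma measurable_sub_kernel (h : G -> R) : continuous h ->
  measurable_fun [set: Borel G * Borel G]
    (fun z : Borel G * Borel G => h ((z.1 : G) - (z.2 : G))).
Proof.
move=> ch; apply: (measurability _ (RGenOInfty.measurableE R)).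
move=> _ [_ [c ->] <-]; rewrite setTI.
have net n : exists VD : set G * seq G, [/\ open VD.1,
    (forall z, exists2 y, y \in VD.2 & VD.1 (z - y)) &
    (forall y z, VD.1 (z - y) -> forall x,
       `|h (x - y) - h (x - z)| < n.+1%:R^-1)].
  have [|V [D ?]] := @finite_uniform_net h n.+1%:R^-1 ch; first by [].
  by exists (V, D).
have {}[VD hVD] := choice net.
(* On the rectangle of [n] and [y], moving from [y] to [z] costs less than [1 / (n + 1)], which the
   raised threshold [c + 1 / (n + 1)] absorbs. *)
rewrite (_ : _ @^-1` _ = \bigcup_n \bigcup_(y in [set` (VD n).2])
   ([set x : Borel G | c + n.+1%:R^-1 < h ((x : G) - y)] `*`
    [set z : Borel G | (VD n).1 ((z : G) - y)])).
  apply: bigcupT_measurable => n; apply: fin_bigcup_measurable => //= y _.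
  apply: measurableX; apply: open_measurable_Borel.
    have chy : continuous (fun x : G => h (x - y)).
      by move=> x; apply: continuous_comp; [exact: continuous_subr|exact: ch].
    have /continuousP/(_ _ (@open_gt R (c + n.+1%:R^-1))) := chy.
    by rewrite /preimage/= => oc; exact: oc.
  have [oV _ _] := hVD n.
  by have /continuousP := continuous_subr y; exact.
apply/seteqP; split => [[x z]/=|[x z]/= [n _ [y /= yD [/= hx Vz]]]].
- rewrite in_itv/= andbT => cx.
  (* Half of the gap is taken because [1 / (n + 1)] is lost twice: in replacing [z] by [y], and in
     the raised threshold. *)
  have [n hn] : exists n, n.+1%:R^-1 < (h (x - z) - c) / 2.
    have e0 : 0 < (h (x - z) - c) / 2 by rewrite divr_gt0// subr_gt0.
    have [n _ hn] := near_infty_natSinv_lt (PosNum e0).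
    by exists n; exact: (hn n (leqnn n)).
  have [_ /(_ z)[y yD Vz] hV] := hVD n; rewrite /= in Vz hV.
  exists n => //; exists y => //=; split => //=.
  have := hV _ _ Vz x; rewrite ltr_norml => /andP[+ _].
  move: hn; rewrite /=; set t := GRing.inv _; lra.
- rewrite in_itv/= andbT.
  have [_ _ hV] := hVD n.
  have := hV _ _ Vz x; rewrite ltr_norml => /andP[_ +].
  by move: hx; set t := GRing.inv _; lra.
Qed.

End Compact.
End BorelGroup.
Arguments continuous_addl {G} a x.
Arguments continuous_subl {G} a x.
Arguments continuous_subr {G} a x.

(** * Real integrals, change of variables and Fubini for difference kernels *)

Section Integrals.
Context {R : realType} {G : topologicalZmodType}.

Section Measure.
Variable mu : {measure set (Borel G) -> \bar R}.
Hypothesis fin : (mu [set: Borel G] < +oo)%E.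

Local Notation int f := (Rintegral mu [set: Borel G] f).
Local Notation L1 f := (mu.-integrable [set: Borel G] (EFin \o f)).

Lemma integrable_mul_bounded (a u : Borel G -> R) (M : R) : L1 a ->
  measurable_fun [set: Borel G] u -> (forall x, `|u x| <= M) ->
  L1 (fun x => a x * u x).
Proof.
move=> La mu_ uM.
apply: (@eq_integrable _ _ _ mu _ _ ((EFin \o a) \* (EFin \o u))%E) => //.
apply: integrableMl => //; exists M; split; first exact: num_real.
by move=> r Mr x _ /=; rewrite (le_trans (uM x))// ltW.
Qed.

Lemma bounded_integrable (u : Borel G -> R) (M : R) :
  measurable_fun [set: Borel G] u -> (forall x, `|u x| <= M) -> L1 u.
Proof.
move=> mu_ uM; apply: measurable_bounded_integrable => //.
exists M; split; first exact: num_real.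
by move=> r Mr x _ /=; rewrite (le_trans (uM x))// ltW.
Qed.

Lemma le_norm_integral_mul (a u : Borel G -> R) (M : R) : L1 a ->
  measurable_fun [set: Borel G] u -> (forall x, `|u x| <= M) ->
  `|int (fun x => a x * u x)| <= M * int (fun x => `|a x|).
Proof.
move=> La mu_ uM; have Lau := integrable_mul_bounded La mu_ uM.
rewrite (le_trans (le_normr_Rintegral measurableT Lau))//.
have La' := integrable_norm La.
rewrite -RintegralZl//; apply: le_Rintegral => //.
- exact: integrable_norm Lau.
- exact: (integrableZl measurableT M La').
- by move=> x _ /=; rewrite normrM mulrC ler_wpM2r.
Qed.

Lemma EFin_Rintegral (f : Borel G -> R) : L1 f ->
  (int f)%:E = (\int[mu]_x (f x)%:E)%E.
Proof. by move=> Lf; rewrite /Rintegral fineK//; exact: integrable_fin_num. Qed.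

Definition preserving (phi : G -> G) :=
  measurable_fun [set: Borel G] (phi : Borel G -> Borel G) /\
  forall A : set (Borel G), measurable A -> mu (phi @^-1` A) = mu A.

Lemma ge0_integral_preserving (phi : G -> G) (f : Borel G -> \bar R) :
  preserving phi -> measurable_fun [set: Borel G] f -> (forall x, 0 <= f x)%E ->
  (\int[mu]_x f (phi x) = \int[mu]_x f x)%E.
Proof.
move=> [mphi pphi] mf f0.
rewrite -(@ge0_integral_pushforward _ _ _ _ _
  (phi : Borel G -> Borel G) mphi mu setT f)//.
by apply: eq_measure_integral => A mA _; exact: pphi.
Qed.

Lemma integrable_preserving (phi : G -> G) (f : Borel G -> R) :
  preserving phi -> L1 f -> L1 (fun x => f (phi x)).
Proof.
move=> pphi /integrableP[mf foo]; apply/integrableP; split.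
  by apply: (measurableT_comp mf); exact: pphi.1.
rewrite (@ge0_integral_preserving phi (fun x => `|(f x)%:E|)%E)//.
exact: measurableT_comp.
Qed.

Lemma Rintegral_preserving (phi : G -> G) (f : Borel G -> R) :
  preserving phi -> L1 f ->
  int (fun x : Borel G => f (phi x)) = int f.
Proof.
move=> pphi Lf; congr fine; have [mphi pp] := pphi.
rewrite -(@integral_pushforward _ _ _ _ _
  (phi : Borel G -> Borel G) mphi mu setT (EFin \o f))//.
- by apply: eq_measure_integral => A mA _; exact: pp.
- exact: measurable_int Lf.
- exact: (integrable_preserving pphi Lf).
Qed.

End Measure.

(* [h (x - y)] need not be measurable on the product for a Borel [h]; it is for
   a continuous [h] because [G] is compact. *)
Lemma Fubini_sub_kernel (cG : compact [set: G])
    (mu : {finite_measure set (Borel G) -> \bar R})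
    (a b : Borel G -> R) (h : G -> R) : continuous h ->
  mu.-integrable [set: Borel G] (EFin \o a) ->
  mu.-integrable [set: Borel G] (EFin \o b) ->
  Rintegral mu [set: Borel G]
    (fun x => b x * Rintegral mu [set: Borel G] (fun y => a y * h (x - y))) =
  Rintegral mu [set: Borel G]
    (fun y => a y * Rintegral mu [set: Borel G] (fun x => b x * h (x - y))).
Proof.
move=> ch La Lb; have fin := fin_num_measure mu _ (@measurableT _ (Borel G)).
have [M M0 hM] := continuous_bounded cG ch.
have mhl x : measurable_fun [set: Borel G] (fun y : Borel G => h ((x : G) - y)).
  apply: (@continuous_measurable_Borel _ _ (fun y : G => h (x - y))) => y.
  by apply: continuous_comp; [exact: continuous_subl|exact: ch].
have mhr y : measurable_fun [set: Borel G] (fun x : Borel G => h ((x : G) - y)).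
  apply: (@continuous_measurable_Borel _ _ (fun x : G => h (x - y))) => x.
  by apply: continuous_comp; [exact: continuous_subr|exact: ch].
pose f (z : Borel G * Borel G) :=
  (b z.1 * (a z.2 * h ((z.1 : G) - (z.2 : G))))%:E.
have ma : measurable_fun setT a by apply/measurable_EFinP; exact: measurable_int La.
have mb : measurable_fun setT b by apply/measurable_EFinP; exact: measurable_int Lb.
have mf : measurable_fun setT f.
  apply/measurable_EFinP; apply: measurable_funM.
    exact: (measurableT_comp mb measurable_fst).
  apply: measurable_funM; first exact: (measurableT_comp ma measurable_snd).
  exact: measurable_sub_kernel.
have Lah x : mu.-integrable [set: Borel G] (EFin \o (fun y => a y * h (x - y))).
  exact: integrable_mul_bounded La (mhl x) (fun y => hM _).
have Lbh y : mu.-integrable [set: Borel G] (EFin \o (fun x => b x * h (x - y))).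
  exact: integrable_mul_bounded Lb (mhr y) (fun y => hM _).
(* Absolute integrability on the product: as [h] is bounded by [M], the inner integral is at most
   [|b x|] times [M] times the [L1] norm of [a]. *)
have foo : (\int[mu]_x \int[mu]_y `|f (x, y)| < +oo)%E.
  apply: (@le_lt_trans _ _ (\int[mu]_x
     (`|b x| * (M * Rintegral mu [set: Borel G] (fun x => `|a x|)))%:E)%E).
    apply: ge0_le_integral => //.
    - by move=> x _; exact: integral_ge0.
    - apply: (measurable_fun_fubini_tonelli_F (abse \o f)) => //=.
      by apply/measurable_EFinP; apply: measurableT_comp => //;
        exact/measurable_EFinP.
    - apply/measurable_EFinP; apply: measurable_funM => //.
      exact: measurableT_comp.
    - move=> x _; rewrite EFinM.
      under eq_integral do rewrite /f /= normrM EFinM.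
      rewrite ge0_integralZl//; last first.
        by apply/measurable_EFinP; apply: measurableT_comp => //;
          exact: measurable_funM.
      rewrite lee_wpmul2l ?lee_fin//.
      have La' := integrable_norm La.
      rewrite EFinM EFin_Rintegral// -integralZl//.
      apply: ge0_le_integral => //.
      + by apply/measurable_EFinP; apply: measurableT_comp => //;
          exact: measurable_funM.
      + apply/measurable_EFinP; apply: measurable_funM => //.
        exact: measurableT_comp.
      + by move=> y _; rewrite lee_fin normrM mulrC ler_wpM2r.
  have -> : (\int[mu]_x
     (`|b x| * (M * Rintegral mu [set: Borel G] (fun x => `|a x|)))%:E)%E =
     (Rintegral mu [set: Borel G] (fun x => `|b x|) *
      (M * Rintegral mu [set: Borel G] (fun x => `|a x|)))%:E.
    have Lb' := integrable_norm Lb.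
    by rewrite EFinM EFin_Rintegral// -integralZr.
  exact: ltry.
have := Fubini ((@integrable12ltyP _ _ _ _ _ mu mu f mf).2 foo).
move=> eqf; apply: (congr1 fine).
transitivity (\int[mu]_x \int[mu]_y f (x, y))%E.
  apply: eq_integral => x _. rewrite EFinM EFin_Rintegral. rewrite -integralZl//.
  exact: Lah.
  exact: Lah.
rewrite eqf; apply: (@eq_integral _ _ _ mu _ (fun y : Borel G =>
  (a y * Rintegral mu [set: Borel G] (fun x => b x * h (x - y)))%:E)) => y _.
rewrite EFinM EFin_Rintegral.
  rewrite -integralZl //; last exact: Lbh.
  by apply: eq_integral => x _ /=; rewrite /f /= -!EFinM mulrCA.
exact: Lbh.
Qed.

End Integrals.

(** * Haar measure on a compact group: Fubini, Urysohn functions and invariance under reflection *)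

Section Haar.
Context {R : realType} {G : topologicalZmodType}.
Variable mu : {measure set (Borel G) -> \bar R}.
Hypothesis fin : (mu [set: Borel G] < +oo)%E.
Hypotheses (HG : hausdorff_space G) (cG : compact [set: G]).
Hypothesis Hmu : haar_measure mu.

Local Notation int f := (Rintegral mu [set: Borel G] f).
Local Notation L1 f := (mu.-integrable [set: Borel G] (EFin \o f)).

(** The hypothesis [fin] is packed into a finite measure structure [nu] on the same set function, so
    that [Fubini_sub_kernel] speaks of [mu] itself. *)
Lemma Fubini_convolution (a b : Borel G -> R) (h : G -> R) : continuous h ->
  L1 a -> L1 b ->
  int (fun x => b x * int (fun y => a y * h (x - y))) =
  int (fun y => a y * int (fun x => b x * h (x - y))).
Proof.
have finmu := lty_fin_num_fun fin.
pose H1 := isFinite.Build _ _ _ (Measure.sort mu) finmu.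
have sfmu : sigma_finite [set: Borel G] mu.
  by apply: fin_num_fun_sigma_finite; rewrite ?measure0.
pose H2 := isSFinite.Build _ _ _ _ (sfinite_measure_sigma_finite sfmu).
pose H3 := isSigmaFinite.Build _ _ _ _ sfmu.
pose nu := HB.pack_for {finite_measure set (Borel G) -> \bar R}
  (Measure.sort mu) H1 H2 H3.
exact: (@Fubini_sub_kernel _ _ cG nu).
Qed.

Lemma Urysohn_compact_open (K U : set G) : compact K -> open U -> K `<=` U ->
  exists h : G -> R, [/\ continuous h, (forall x, 0 <= h x <= 1),
    (forall x, K x -> h x = 1) & (forall x, ~ U x -> h x = 0)].
Proof.
move=> cK oU KU; have normG := compact_normal HG cG.
have [||||f [cf f0 f1 f01]] :=
  @urysohn_ext_itv G R normG (~` U) K 0 1.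
- exact: open_closedC.
- exact: compact_closed.
- by apply/disjoints_subset => x nUx Kx; apply: nUx; exact: KU.
- exact: ltr01.
exists f; split => //.
- by move=> x; have /= := f01 (f x); rewrite in_itv/=; apply; exists x.
- by move=> x Kx; apply: f1; exists x.
- by move=> x Ux; apply: f0; exists x.
Qed.

Lemma continuous_integrable (h : G -> R) : continuous h -> L1 h.
Proof.
move=> ch; have [M _ hM] := continuous_bounded cG ch.
apply: (@bounded_integrable _ _ mu fin h M) => //.
exact: continuous_measurable_Borel.
Qed.

Lemma mu_gt0 : 0 < fine (mu [set: Borel G]).
Proof.
have [_ _ mu0 _ _] := Hmu.
rewrite fine_gt0// fin andbT; apply: (mu0 setT); first exact: openT.
by exists 0.
Qed.

Lemma Rintegral_cst1 : int (fun=> 1) = fine (mu [set: Borel G]).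
Proof. by rewrite Rintegral_cst// mul1r. Qed.

Lemma preserving_subr (a : G) : preserving mu (fun x => x - a).
Proof.
split; first by apply: continuous_measurable_endo; exact: continuous_subr.
move=> A mA; have [inv _ _ _ _] := Hmu; rewrite -(inv A a mA).
congr (mu _); apply/seteqP; split => [x /= Ax|_ [x Ax <-] /=].
  by exists (x - a) => //; rewrite addrC subrK.
by rewrite addrC addKr.
Qed.

Lemma continuous_oppr_comp (h : G -> R) :
  continuous h -> continuous (fun x => h (- x)).
Proof.
by move=> ch x; apply: continuous_comp; [exact: opp_continuous|exact: ch].
Qed.

(* Both sides, multiplied by the mass of [mu], are the double integral of
   [h (x - y)]. *)
Lemma Rintegral_opp_continuous (h : G -> R) : continuous h ->
  int (fun x => h (- x)) = int h.
Proof.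
move=> ch.
have L11 : L1 (fun=> 1).
  by apply: (@continuous_integrable (fun=> 1)); exact: cst_continuous.
have := Fubini_convolution ch L11 L11.
have Lh := continuous_integrable ch.
have Lh' := continuous_integrable (continuous_oppr_comp ch).
under eq_Rintegral => x _.
  under eq_Rintegral => y _.
    rewrite mul1r (_ : h (x - y) = h (- (y - x))); last by rewrite opprB.
    over.
  rewrite (Rintegral_preserving (preserving_subr x) Lh').
  over.
under [RHS]eq_Rintegral => y _.
  under eq_Rintegral do rewrite mul1r.
  rewrite (Rintegral_preserving (preserving_subr y) Lh).
  over.
rewrite !RintegralZr// Rintegral_cst1; apply: mulfI.
by rewrite gt_eqF// mu_gt0.
Qed.

(** By inner regularity it is enough to bound [mu K] for compact [K] inside [U]. A Urysohn function
    [h] lies between the indicators of [K] and [U], and its integral does not change under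
    reflection. *)
Lemma le_mu_opp_open (U : set G) : open U -> (mu U <= mu (-%R @^-1` U))%E.
Proof.
move=> oU; have [_ _ _ _ inner] := Hmu; rewrite inner//.
apply: ge_ereal_sup => _ [K [cK KU] <-].
have [h [ch h01 h1 h0]] := Urysohn_compact_open cK oU KU.
have mK := compact_measurable_Borel HG cK.
have mU := open_measurable_Borel oU.
have oU' : open (-%R @^-1` U) by have /continuousP := @opp_continuous G; exact.
have mU' := open_measurable_Borel oU'.
have ch' := continuous_oppr_comp ch.
have mh := continuous_measurable_Borel ch.
have mh' := continuous_measurable_Borel ch'.
apply: (@le_trans _ _ (int h)%:E).
  rewrite EFin_Rintegral//; last exact: continuous_integrable.
  rewrite -(setIT K) -integral_indic//; apply: ge0_le_integral => //.
  - exact/measurable_EFinP.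
  - exact/measurable_EFinP.
  - move=> x _; rewrite lee_fin indicE; case: (boolP (x \in K)); rewrite ?inE.
      by move/h1 => ->.
    by have /andP[] := h01 x.
rewrite -(Rintegral_opp_continuous ch) EFin_Rintegral//; last first.
  exact: continuous_integrable.
rewrite -(setIT (_ @^-1` _)) -integral_indic//; apply: ge0_le_integral => //.
- by move=> x _; rewrite lee_fin; have /andP[] := h01 (- x).
- exact/measurable_EFinP.
- exact/measurable_EFinP.
- move=> x _; rewrite lee_fin indicE.
  have [|nU] := boolP (x \in _); first by have /andP[] := h01 (- x).
  by rewrite h0//= => Ux; move/negP: nU; apply; rewrite inE.
Qed.

(** Applying [le_mu_opp_open] to the reflected set gives the opposite inequality on open sets, and
    outer regularity carries it to Borel sets. Since reflection is an involution, one inequality for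
    all Borel sets yields equality. *)
Lemma preserving_opp : preserving mu -%R.
Proof.
have copp := @opp_continuous G; have moppr := continuous_measurable_endo copp.
split => // A mA.
have oppKset (B : set G) : -%R @^-1` (-%R @^-1` B) = B.
  by apply/seteqP; split => x /=; rewrite opprK.
have oU' (U : set G) : open U -> open (-%R @^-1` U).
  by move=> oU; have /continuousP := @opp_continuous G; exact.
have muU (U : set G) : open U -> (mu (-%R @^-1` U) <= mu U)%E.
  by move=> oU; rewrite -[X in (_ <= mu X)%E]oppKset; exact/le_mu_opp_open/oU'.
have leA (B : set (Borel G)) : measurable B -> (mu (-%R @^-1` B) <= mu B)%E.
  move=> mB; have [_ _ _ outer _] := Hmu; rewrite (outer B)//.
  apply: le_ereal_inf_tmp => _ [U [oU BU] <-]; rewrite (le_trans _ (muU _ oU))//.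
  apply: le_measure; rewrite ?inE.
  - by have := moppr measurableT _ mB; rewrite setTI.
  - by apply: open_measurable_Borel; exact: oU'.
  - by move=> x /= Bx; exact: BU.
have mA' : measurable (-%R @^-1` A : set (Borel G)).
  by have := moppr measurableT _ mA; rewrite setTI.
apply/eqP; rewrite eq_le leA//=.
by rewrite -[X in (mu X <= _)%E]oppKset leA.
Qed.

Lemma preserving_subl (a : G) : preserving mu (fun x => a - x).
Proof.
have [m1 p1] := preserving_subr a; have [m2 p2] := preserving_opp.
split; first by apply: continuous_measurable_endo; exact: continuous_subl.
move=> A mA.
have mA' : measurable (-%R @^-1` A : set (Borel G)).
  by have := m2 measurableT _ mA; rewrite setTI.
rewrite -(p2 A mA) -(p1 _ mA'); congr (mu _).
by apply/seteqP; split => x /=; rewrite opprB.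
Qed.

End Haar.

(** Let [K] be a compact neighbourhood of [0]. If finitely many translates of [K] cover [G], then
    [G] is compact. Otherwise points can be chosen one after another so that the translates of a
    smaller [V] are disjoint, and their equal positive masses exceed the finite mass of [G]. *)
Lemma finite_haar_compact {R : realType} {G : topologicalZmodType}
    (mu : {measure set (Borel G) -> \bar R}) :
  locally_compact [set: G] -> haar_measure mu ->
  (mu [set: Borel G] < +oo)%E -> compact [set: G].
Proof.
move=> lcG Hmu fin; have [inv _ mu0 _ _] := Hmu.
have [K nK [cK _]] := lcG 0 I; rewrite withinET in nK.
(* Differences of points of [V] lie in [K], so a common point of [x + V] and [z + V] puts [z] in
   [x + K]. *)
have [V [oV V0 VK]] : exists V : set G,
    [/\ open V, V 0 & forall v w, V v -> V w -> K (v - w)].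
  have : nbhs (0 : G, 0 : G) [set z : G * G | K (z.1 - z.2)].
    have := @sub_continuous G (0, 0); rewrite /continuous_at /= subrr.
    by apply.
  move=> [[A B] /= [nA nB] AB].
  exists (interior (A `&` B)); split; first exact: open_interior.
    exact: filterI.
  move=> v w /interior_subset [Av _] /interior_subset [_ Bw].
  exact: (AB (v, w)).
pose tr (S : set G) x := [set x + v | v in S].
have trE S x : tr S x = [set y | S (y - x)].
  apply/seteqP; split => [_ [v Sv <-] /=|y /= Sy].
    by rewrite addrC addKr.
  by exists (y - x) => //; rewrite addrC subrK.
have oW (s : seq G) : open (\big[setU/set0]_(x <- s) tr V x).
  elim/big_ind: _ => //; [exact: open0|exact: openU|move=> x _].
  by rewrite trE; have /continuousP := continuous_subr x; exact.
have muV0 : 0 < fine (mu V).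
  rewrite fine_gt0// mu0//=; last by exists 0.
  rewrite (le_lt_trans _ fin)// le_measure// inE//.
  exact: open_measurable_Borel.
have [[s sG]|ncov] :=
  pselect (exists s : seq G, forall z, exists2 x, x \in s & K (z - x)).
  suff -> : [set: G] = \big[setU/set0]_(x <- s) tr K x.
    apply: bigsetU_compact => x _; apply: continuous_compact => //.
    exact/continuous_subspaceT/continuous_addl.
  apply/esym/seteqP; split => // z _; have [x xs Kx] := sG z.
  rewrite -bigcup_seq; exists x => //.
  by rewrite trE.
have muVfin : mu V \is a fin_num.
  rewrite ge0_fin_numE// (le_lt_trans _ fin)// le_measure// inE//.
  exact: open_measurable_Borel.
(* By the failure of covering, the next centre [z] avoids all [x + K] chosen so far, whence [z + V]
   is disjoint from the earlier translates. *)
have disj n : exists s : seq G,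
    mu (\big[setU/set0]_(x <- s) tr V x) = (n%:R * fine (mu V))%:E.
  elim: n => [|n [s IHs]]; first by exists [::]; rewrite big_nil measure0 mul0r.
  have [z nz] : exists z, forall x, x \in s -> ~ K (z - x).
    apply: contrapT => nz; apply: ncov; exists s => z.
    apply: contrapT => nx; apply: nz; exists z => x xs Kx; apply: nx.
    by exists x.
  have eqU : (mu (tr V z `|` \big[setU/set0]_(x <- s) tr V x) =
      mu (tr V z) + mu (\big[setU/set0]_(x <- s) tr V x))%E.
    apply: measureU.
    - apply: open_measurable_Borel; rewrite trE.
      by have /continuousP := continuous_subr z; exact.
    - exact: open_measurable_Borel.
    - apply/seteqP; split => // y [Vy]; rewrite -bigcup_seq => -[x /= xs Vx].
      move: Vy Vx; rewrite !trE /= => Vy Vx; apply: (nz x xs).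
      by have := VK _ _ Vx Vy; rewrite opprB addrC subrKA.
  have muz : mu (tr V z) = mu V by apply: inv; exact: open_measurable_Borel.
  exists (z :: s); rewrite big_cons eqU IHs muz.
  by rewrite -[mu V]fineK// -EFinD -natr1 mulrDl mul1r addrC.
(* More than [mu G / mu V] disjoint translates cannot fit into [G]. *)
have := archi_boundP (divr_ge0 (fine_ge0 (measure_ge0 mu setT)) (ltW muV0)).
rewrite ltr_pdivrMr//; set n := Num.bound _ => mun.
have [s hs] := disj n.
have : (mu (\big[setU/set0]_(x <- s) tr V x) <= mu [set: Borel G])%E.
  by apply: le_measure; rewrite ?inE//; exact: open_measurable_Borel.
rewrite hs -[mu setT]fineK ?ge0_fin_numE// lee_fin => /(lt_le_trans mun).
by rewrite ltxx.
Qed.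

(** * Density of continuous functions in [L1] and approximate identities *)

Section Approximation.
Context {R : realType} {G : topologicalZmodType}.
Variable mu : {measure set (Borel G) -> \bar R}.
Hypothesis fin : (mu [set: Borel G] < +oo)%E.
Hypotheses (HG : hausdorff_space G) (cG : compact [set: G]).
Hypothesis Hmu : haar_measure mu.

Local Notation int f := (Rintegral mu [set: Borel G] f).
Local Notation L1 f := (mu.-integrable [set: Borel G] (EFin \o f)).

Lemma Rintegral_dist_triangle (a b c : Borel G -> R) : L1 a -> L1 b -> L1 c ->
  int (fun x => `|a x - c x|) <=
  int (fun x => `|a x - b x|) + int (fun x => `|b x - c x|).
Proof.
move=> La Lb Lc.
have Lab := integrable_norm (integrableB measurableT La Lb).
have Lbc := integrable_norm (integrableB measurableT Lb Lc).
have Lac := integrable_norm (integrableB measurableT La Lc).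
rewrite -RintegralD//; apply: le_Rintegral => //.
- exact: (integrableD measurableT Lab Lbc).
- by move=> x _; exact: ler_distD.
Qed.

(** Membership in the [L1] closure of the continuous functions. *)
Definition continuous_approx (a : Borel G -> R) :=
  forall e : R, 0 < e ->
  exists2 g : G -> R, continuous g & int (fun x => `|a x - g x|) <= e.

(** For [h] equal to 1 on [K] and 0 off [U], the error is at most the sum of the indicators of [U]
    minus [A] and of [U] minus [K], each of mass below [e / 2]. *)
Lemma continuous_approx_indic (A : set (Borel G)) :
  measurable A -> continuous_approx \1_A.
Proof.
move=> mA e e0; have [_ _ _ outer inner] := Hmu.
have finmu := lty_fin_num_fun fin.
have e20 : 0 < e / 2 by rewrite divr_gt0.
have [U [oU AU] UA] : exists2 U : set G, open U /\ A `<=` U &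
    (mu U < mu A + (e / 2)%:E)%E.
  have := finmu A mA; rewrite (outer A mA) => fA.
  by have [_ [U hU <-] hlt] := lb_ereal_inf_adherent e20 fA; exists U.
have mU := open_measurable_Borel oU.
(* [K] is taken inside [U] and not inside [A], since [haar_measure] states inner regularity for open
   sets. *)
have [K [cK KU] UK] : exists2 K : set G, compact K /\ K `<=` U &
    (mu U - (e / 2)%:E < mu K)%E.
  have := finmu U mU; rewrite (inner U oU) => fU.
  by have [_ [K hK <-] hlt] := ub_ereal_sup_adherent e20 fU; exists K.
have mK := compact_measurable_Borel HG cK.
have [h [ch h01 h1 h0]] := @Urysohn_compact_open R G HG cG K U cK oU KU.
exists h => //.
have Lh := continuous_integrable fin cG ch.
have LI (B : set (Borel G)) : measurable B -> L1 (\1_B : Borel G -> R).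
  move=> mB; apply: (@bounded_integrable _ _ mu fin _ 1).
    exact: measurable_indic.
  by move=> x; rewrite indicE; case: (_ \in _); rewrite ?normr1 ?normr0.
have intI (B : set (Borel G)) : measurable B ->
    int (\1_B : Borel G -> R) = fine (mu B).
  by move=> mB; rewrite /Rintegral integral_indic// setIT.
have mUA := measurableD mU mA; have mUK := measurableD mU mK.
have le_int : int (fun x => `|\1_A x - h x|) <=
    int (fun x : Borel G => \1_(U `\` A) x + \1_(U `\` K) x).
  apply: le_Rintegral => //.
  - exact: (integrable_norm (integrableB measurableT (LI _ mA) Lh)).
  - exact: (integrableD measurableT (LI _ mUA) (LI _ mUK)).
  - move=> x _; rewrite !indicE !in_setD.
    have /andP[hx0 hx1] := h01 x.
    have [xU|xU] := boolP (x \in U); last first.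
      rewrite h0; last by move=> Ux; move/negP: xU; apply; rewrite inE.
      rewrite memNset ?subrr ?normr0 ?addr0//.
      by move=> Ax; move/negP: xU; apply; rewrite inE; exact: AU.
    have [xK|xK] := boolP (x \in K).
      rewrite h1; last by rewrite inE in xK.
      by case: (x \in A); rewrite /= ?subrr ?sub0r ?normrN ?normr0 ?normr1 ?addr0 ?add0r.
    case: (x \in A) => /=; rewrite ?add0r ?addr0.
      by rewrite ger0_norm; lra.
    by rewrite normrN ger0_norm//; lra.
apply: (le_trans le_int); rewrite RintegralD//; [|exact: LI|exact: LI].
rewrite !intI//.
have fA := finmu A mA; have fU := finmu U mU; have fK := finmu K mK.
have -> : fine (mu (U `\` A)) = fine (mu U) - fine (mu A).
  rewrite (measureD mU mA) ?ltey_eq ?fU//.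
  by rewrite (setIidr AU) fineB.
have -> : fine (mu (U `\` K)) = fine (mu U) - fine (mu K).
  rewrite (measureD mU mK) ?ltey_eq ?fU//.
  by rewrite (setIidr KU) fineB.
move: UA UK; rewrite -[mu U]fineK// -[mu A]fineK// -[mu K]fineK//.
by rewrite -EFinB -EFinD !lte_fin; lra.
Qed.

Lemma continuous_approxD (a b : Borel G -> R) : L1 a -> L1 b ->
  continuous_approx a -> continuous_approx b ->
  continuous_approx (fun x => a x + b x).
Proof.
move=> La Lb ha hb e e0; have e20 : 0 < e / 2 by rewrite divr_gt0.
have [g cg ag] := ha _ e20; have [k ck bk] := hb _ e20.
have cgk : continuous (fun x => g x + k x).
  by move=> x; apply: (@continuousD R R^o); [exact: cg|exact: ck].
exists (fun x => g x + k x) => //.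
have Lg := continuous_integrable fin cG cg.
have Lk := continuous_integrable fin cG ck.
have Lag := integrable_norm (integrableB measurableT La Lg).
have Lbk := integrable_norm (integrableB measurableT Lb Lk).
rewrite [e]splitr; apply: le_trans (lerD ag bk).
rewrite -RintegralD//; apply: le_Rintegral => //.
- exact: (integrable_norm (integrableB measurableT
    (integrableD measurableT La Lb) (continuous_integrable fin cG cgk))).
- exact: (integrableD measurableT Lag Lbk).
- move=> x _; rewrite [X in `|X|](_ : _ = (a x - g x) + (b x - k x)) ?ler_normD//.
  by rewrite opprD addrACA.
Qed.

Lemma continuous_approxZ (r : R) (a : Borel G -> R) : L1 a ->
  continuous_approx a -> continuous_approx (fun x => r * a x).
Proof.
(* The added 1 keeps the divisor positive when [r] is 0. *)
move=> La ha e e0; have r0 : 0 < `|r| + 1 by rewrite ltr_wpDl.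
have [g cg ag] := ha _ (divr_gt0 e0 r0).
exists (fun x => r * g x).
  by move=> x; apply: continuousM; [exact: cvg_cst|exact: cg].
have Lg := continuous_integrable fin cG cg.
have Lag := integrable_norm (integrableB measurableT La Lg).
under eq_Rintegral do rewrite -mulrBr normrM.
rewrite RintegralZl//.
apply: (@le_trans _ _ (`|r| * (e / (`|r| + 1)))); first by rewrite ler_wpM2l.
by rewrite mulrCA ler_piMr ?(ltW e0)// ler_pdivrMr// mul1r lerDl.
Qed.

Import HBSimple.

(** Simple functions are dense in [L1], and each is a finite combination of indicators of Borel
    sets. *)
Lemma integrable_continuous_approx (a : Borel G -> R) :
  L1 a -> continuous_approx a.
Proof.
move=> La e e0; have e20 : 0 < e / 2 by rewrite divr_gt0.
have [g_ [Lg _ gcvg]] := approximation_sfun_integrable measurableT La.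
have [n an] : exists n, int (fun x => `|a x - g_ n x|) <= e / 2.
  move/fine_cvgP : gcvg => [_ /cvgrPdist_le /(_ _ e20)] [n _ /(_ n (leqnn n))].
  rewrite /= sub0r normrN => hn; exists n.
  exact: le_trans (ler_norm _) hn.
have {}Lg := Lg n.
suff [k ck gk] : exists2 k : G -> R, continuous k &
    int (fun x => `|g_ n x - k x|) <= e / 2.
  exists k => //; rewrite [e]splitr; apply: le_trans (lerD an gk).
  exact: Rintegral_dist_triangle La Lg (continuous_integrable fin cG ck).
move: e20; move: (e / 2); change (continuous_approx (g_ n)).
rewrite (_ : (g_ n : Borel G -> R) =
  (fun x => \sum_(y \in range (g_ n)) y * \1_(g_ n @^-1` [set y]) x)); last first.
  by apply/funext => x; rewrite fimfunE.
under eq_fun do rewrite fsbig_finite//=.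
have LI y : L1 (\1_(g_ n @^-1` [set y]) : Borel G -> R).
  apply: (@bounded_integrable _ _ mu fin _ 1).
    exact/measurable_indic/measurable_sfunP.
  by move=> x; rewrite indicE; case: (_ \in _); rewrite ?normr1 ?normr0.
(* The sum is generalised from the range of [g_ n] to any list, to allow induction. Integrability is
   proved along with it because [continuous_approxD] asks for it. *)
pose S s (x : Borel G) : R := \sum_(y <- s) y * \1_(g_ n @^-1` [set y]) x.
have SE y s : S (y :: s) = fun x => y * \1_(g_ n @^-1` [set y]) x + S s x.
  by apply/funext => x; rewrite /S big_cons.
suff hS s : L1 (S s) /\ continuous_approx (S s) by exact: (hS _).2.
elim: s => [|y s [Ls IHs]].
  have -> : S nil = cst 0 by apply/funext => x; rewrite /S big_nil.
  split; first exact: integrable0.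
  move=> d d0; exists (cst 0); first exact: cst_continuous.
  under eq_Rintegral do rewrite subrr normr0.
  by rewrite Rintegral_cst// mul0r ltW.
have Ly := integrableZl measurableT y (LI y).
rewrite SE; split; first exact: (integrableD measurableT Ly Ls).
apply: (continuous_approxD Ly Ls) => //.
apply: continuous_approxZ => //.
exact/continuous_approx_indic/measurable_sfunP.
Qed.

(** The values at [x0] and [x] differ by the integral of [a y] times [u (x0 - y) - u (x - y)].
    Uniform continuity of [u] makes the second factor small for all [y] at once. *)
Lemma continuous_convolution (a : Borel G -> R) (u : G -> R) : L1 a ->
  continuous u -> continuous (fun x => int (fun y => a y * u (x - y))).
Proof.
move=> La cu x0.
have cux x : continuous (fun y => u (x - y)).
  by move=> y; apply: continuous_comp; [exact: continuous_subl|exact: cu].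
have [M _ uM] := continuous_bounded cG cu.
have Lau x : L1 (fun y => a y * u (x - y)).
  apply: (@integrable_mul_bounded _ _ mu a _ M) => //.
  exact: (continuous_measurable_Borel (cux x)).
apply/cvgrPdist_le => e e0.
set A := int (fun x => `|a x|).
have A0 : 0 < A + 1 by rewrite ltr_wpDl// Rintegral_ge0.
have near_u := uniform_continuity cG cu (divr_gt0 e0 A0).
have cx0 : (fun x : G => x - x0) @ x0 --> (0 : G).
  by have := continuous_subr x0 x0; rewrite /continuous_at subrr.
have near_x0 : \forall x \near x0,
    forall y, `|u (y + (x - x0)) - u y| < e / (A + 1).
  exact: (cx0 _ near_u).
near=> x.
have hx : forall y, `|u (y + (x - x0)) - u y| < e / (A + 1) by near: x.
rewrite -(@RintegralB _ _ _ mu)//.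
under eq_Rintegral do rewrite -mulrBr.
apply: (@le_trans _ _ (e / (A + 1) * A)); last first.
  by rewrite mulrAC -mulrA ler_piMr ?(ltW e0)// ler_pdivrMr// mul1r lerDl.
apply: le_norm_integral_mul => //.
  apply: measurable_funB; first exact: (continuous_measurable_Borel (cux x0)).
  exact: (continuous_measurable_Borel (cux x)).
move=> y; rewrite distrC ltW//.
by have := hx (x0 - y); rewrite [_ + (x - x0)]addrC subrKA.
Unshelve. all: by end_near.
Qed.

(** Inner regularity puts a compact set of positive mass inside [V]. A Urysohn function for it has
    positive integral and can be normalised. *)
Lemma bump_function (V : set G) : open V -> V 0 ->
  exists u : G -> R, [/\ continuous u, (forall x, 0 <= u x),
    (forall x, ~ V x -> u x = 0) & int u = 1].
Proof.
move=> oV V0; have [_ _ mu0 _ inner] := Hmu.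
have [K [cK KV] K0] : exists2 K : set G, compact K /\ K `<=` V & (0 < mu K)%E.
  have V_gt0 : (0 < mu V)%E by apply: mu0 => //; exists 0.
  move: V_gt0; rewrite inner// => /ereal_sup_gt[_ [K hK <-] ?].
  by exists K.
have [h [ch h01 h1 h0]] := @Urysohn_compact_open R G HG cG K V cK oV KV.
have mK := compact_measurable_Borel HG cK.
have Lh := continuous_integrable fin cG ch.
have inth : 0 < int h.
  rewrite -lte_fin EFin_Rintegral//; apply: (lt_le_trans K0).
  rewrite -(setIT K) -integral_indic//; apply: ge0_le_integral => //.
  - exact/measurable_EFinP.
  - by apply/measurable_EFinP; exact: (continuous_measurable_Borel ch).
  - move=> x _; rewrite lee_fin indicE; case: (boolP (x \in K)); rewrite ?inE.
      by move/h1 => ->.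
    by have /andP[] := h01 x.
exists (fun x => (int h)^-1 * h x); split.
- by move=> x; apply: (@continuousM _ _ (fun=> (int h)^-1) h); [exact: cvg_cst|exact: ch].
- by move=> x; rewrite mulr_ge0 ?invr_ge0 ?(ltW inth)//; have /andP[] := h01 x.
- by move=> x /h0 ->; rewrite mulr0.
- by rewrite RintegralZl// mulVf// gt_eqF.
Qed.

(** With [g] continuous and close to [a], the three errors from [a] to [g], from [g] to [g * u] and
    from [g * u] to [a * u] are each at most [e / 3]. [V] is chosen before [u], so that one bump can
    serve several functions through an intersection of neighbourhoods. *)
Lemma approximate_identity (a : Borel G -> R) (e : R) : L1 a -> 0 < e ->
  exists V : set G, [/\ open V, V 0 &
    forall u : G -> R, continuous u -> (forall x, 0 <= u x) ->
      (forall x, ~ V x -> u x = 0) -> int u = 1 ->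
      int (fun x => `|a x - int (fun y => a y * u (x - y))|) <= e].
Proof.
move=> La e0; have e30 : 0 < e / 3 by rewrite divr_gt0.
have [g cg ag] := integrable_continuous_approx La e30.
have Lg := continuous_integrable fin cG cg.
have m0 := mu_gt0 fin Hmu; set m := fine _ in m0.
(* A uniform error of [e / 3 / m] integrates to [e / 3] over [G], whose mass is [m]. *)
have d0 : 0 < e / 3 / m by rewrite divr_gt0.
have near_g := uniform_continuity cG cg d0.
pose V := interior [set v : G | forall x, `|g (x + v) - g x| < e / 3 / m].
exists V; split; [exact: open_interior|exact: near_g|].
move=> u cu u0 uV intu.
have Lu := continuous_integrable fin cG cu.
have [M _ uM] := continuous_bounded cG cu.
have cux x : continuous (fun y => u (x - y)).
  by move=> y; apply: continuous_comp; [exact: continuous_subl|exact: cu].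
have Luxl x : L1 (fun y => u (x - y)) by exact: continuous_integrable.
have Lmul b x : L1 b -> L1 (fun y => b y * u (x - y)).
  move=> Lb; apply: (@integrable_mul_bounded _ _ mu b _ M) => //.
  exact: (continuous_measurable_Borel (cux x)).
have intux x : int (fun y => u (x - y)) = 1.
  rewrite -intu; apply: (@Rintegral_preserving _ _ mu (fun y => x - y)) => //.
  exact: preserving_subl.
have intuy y : int (fun x => u (x - y)) = 1.
  rewrite -intu; apply: (@Rintegral_preserving _ _ mu (fun x => x - y)) => //.
  exact: preserving_subr.
have Lcv b : L1 b -> L1 (fun x => int (fun y => b y * u (x - y))).
  by move=> Lb; exact: (continuous_integrable fin cG (continuous_convolution Lb cu)).
have gu : int (fun x => `|g x - int (fun y => g y * u (x - y))|) <= e / 3.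
  apply: (@le_trans _ _ (int (fun=> e / 3 / m))); last first.
    by rewrite Rintegral_cst// divfK// gt_eqF.
  apply: le_Rintegral => //.
  - exact: (integrable_norm (integrableB measurableT Lg (Lcv _ Lg))).
  - exact: (@continuous_integrable _ _ mu fin cG (cst _) (@cst_continuous _ _ _)).
  move=> x _.
  (* As [u (x - y)] has integral 1 in [y], the number [g x] may be moved under the integral. The
     integrand then lives where [x - y] is in [V], and there [g x] and [g y] are close. *)
  have -> : g x - int (fun y => g y * u (x - y)) =
      int (fun y => g x * u (x - y)) - int (fun y => g y * u (x - y)).
    by rewrite RintegralZl// intux mulr1.
  rewrite -RintegralB//; [|exact: (integrableZl measurableT (g x) (Luxl x))|exact: Lmul].
  under eq_Rintegral do rewrite -mulrBl.
  have Lgx : L1 (fun y => (g x - g y) * u (x - y)).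
    have cgx : continuous (fun y => g x - g y).
      by move=> y; apply: (@continuousB R R^o); [exact: cst_continuous|exact: cg].
    exact: (Lmul _ _ (continuous_integrable fin cG cgx)).
  rewrite (le_trans (le_normr_Rintegral measurableT Lgx))//.
  have -> : e / 3 / m = e / 3 / m * int (fun y => u (x - y)).
    by rewrite intux mulr1.
  rewrite -RintegralZl//.
  apply: le_Rintegral => //.
  - exact: (integrable_norm Lgx).
  - exact: (integrableZl measurableT (e / 3 / m) (Luxl x)).
  - move=> y _; rewrite normrM [`|u _|]ger0_norm//.
    have [Vxy|/uV ->] := pselect (V (x - y)); last by rewrite !mulr0.
    rewrite ler_wpM2r// ltW//.
    by have := interior_subset Vxy y; rewrite [y + _]addrC subrK.
have agu : int (fun x => `|int (fun y => g y * u (x - y)) -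
                           int (fun y => a y * u (x - y))|) <= e / 3.
  have Lag := integrable_norm (integrableB measurableT La Lg).
  have L11 := @continuous_integrable _ _ mu fin cG (cst 1) (@cst_continuous _ _ _).
  apply: (le_trans _ ag).
  (* Convolution with [u] does not increase the [L1] norm: by Fubini [u (x - y)] is integrated in
     [x] first, which gives 1. *)
  rewrite [leRHS](_ : _ =
      int (fun x => 1 * int (fun y => `|a y - g y| * u (x - y)))); last first.
    rewrite (Fubini_convolution fin cG cu Lag L11).
    apply: eq_Rintegral => y _.
    by under eq_Rintegral do rewrite mul1r; rewrite intuy mulr1.
  under [leRHS]eq_Rintegral do rewrite mul1r.
  apply: le_Rintegral => //.
  - exact: (integrable_norm (integrableB measurableT (Lcv _ Lg) (Lcv _ La))).
  - exact: (Lcv _ Lag).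
  - move=> x _; rewrite -(@RintegralB _ _ _ mu)//; [|exact: Lmul|exact: Lmul].
    have Lgau := Lmul _ x (integrableB measurableT Lg La).
    under eq_Rintegral do rewrite -mulrBl.
    rewrite (le_trans (le_normr_Rintegral measurableT Lgau))//.
    apply: le_Rintegral => //.
    + exact: (integrable_norm Lgau).
    + exact: (Lmul _ x Lag).
    + by move=> y _; rewrite normrM [`|u _|]ger0_norm// distrC.
have e3 : e = e / 3 + (e / 3 + e / 3) by field.
rewrite [leRHS]e3.
apply: le_trans (Rintegral_dist_triangle La Lg (Lcv _ La)) (lerD ag _).
exact: le_trans (Rintegral_dist_triangle Lg (Lcv _ Lg) (Lcv _ La)) (lerD gu agu).
Qed.

End Approximation.

(** * Real and imaginary parts and the complex modulus *)

Section ComplexModulus.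
Context {R : realType}.
Implicit Types x y : R[i].

Lemma complex_ReM x y : complex.Re (x * y) =
  complex.Re x * complex.Re y - complex.Im x * complex.Im y.
Proof. by case: x y => [a b] [c d]. Qed.

Lemma complex_ImM x y : complex.Im (x * y) =
  complex.Re x * complex.Im y + complex.Im x * complex.Re y.
Proof. by case: x y => [a b] [c d]. Qed.

Lemma complex_ReB x y : complex.Re (x - y) = complex.Re x - complex.Re y.
Proof. by case: x y => [a b] [c d]. Qed.

Lemma complex_ImB x y : complex.Im (x - y) = complex.Im x - complex.Im y.
Proof. by case: x y => [a b] [c d]. Qed.

Lemma cabs_ge0 x : 0 <= cabs x.
Proof. exact: sqrtr_ge0. Qed.

Lemma cabsD x y : cabs (x + y) <= cabs x + cabs y.
Proof. by case: x y => [a b] [c d]; exact: (@le_normcD R (a +i* b)%C (c +i* d)%C). Qed.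

Lemma Re_le_cabs x : `|complex.Re x| <= cabs x.
Proof. by rewrite -sqrtr_sqr ler_wsqrtr// lerDl sqr_ge0. Qed.

Lemma Im_le_cabs x : `|complex.Im x| <= cabs x.
Proof. by rewrite -sqrtr_sqr ler_wsqrtr// lerDr sqr_ge0. Qed.

Lemma cabs_le_ReIm x : cabs x <= `|complex.Re x| + `|complex.Im x|.
Proof.
rewrite -[leRHS]ger0_norm ?addr_ge0// -sqrtr_sqr ler_wsqrtr//.
rewrite sqrrD !real_normK ?num_real// [leRHS]addrAC lerDl.
by rewrite mulrn_wge0// mulr_ge0.
Qed.

End ComplexModulus.

(** * Integrals of complex-valued functions through their real and imaginary parts *)

Section ComplexIntegral.
Context {R : realType} {G : topologicalZmodType}.
Variable mu : {measure set (Borel G) -> \bar R}.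
Implicit Types (f g : G -> R[i]) (k : G -> R).

Local Notation int f := (Rintegral mu [set: Borel G] f).
Local Notation L1 f := (mu.-integrable [set: Borel G] (EFin \o f)).
Local Notation re f := (fun x : Borel G => complex.Re (f x)).
Local Notation im f := (fun x : Borel G => complex.Im (f x)).

Definition cintegrable f := L1 (re f) /\ L1 (im f).

Definition ccontinuous f :=
  continuous (fun x : G => complex.Re (f x)) /\
  continuous (fun x : G => complex.Im (f x)).

Lemma measurable_cabs f : cmeasurable f ->
  measurable_fun [set: Borel G] (fun x : Borel G => cabs (f x)).
Proof.
move=> [mre mim].
apply: (@measurableT_comp _ _ _ _ _ _ (@Num.sqrt R)).
  apply: continuous_measurable_fun; exact: sqrt_continuous.
by apply: measurable_funD; apply: measurable_funX.
Qed.

(** The modulus dominates both parts and is dominated by the sum of their absolute values. *)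
Lemma inL1_cintegrable f : inL1 mu f <-> cintegrable f.
Proof.
split=> [[mf f1]|[Lre Lim]].
  have mabs := measurable_cabs mf.
  have Labs : L1 (fun x : Borel G => cabs (f x)).
    apply/integrableP; split; first exact/measurable_EFinP.
    by under eq_integral do rewrite /= ger0_norm ?cabs_ge0//.
  have [mre mim] := mf; split; apply: le_integrable Labs => //.
  - exact/measurable_EFinP.
  - by move=> x _ /=; rewrite lee_fin [leRHS]ger0_norm ?cabs_ge0// Re_le_cabs.
  - exact/measurable_EFinP.
  - by move=> x _ /=; rewrite lee_fin [leRHS]ger0_norm ?cabs_ge0// Im_le_cabs.
have mf : cmeasurable f.
  by split; apply/measurable_EFinP; [exact: measurable_int Lre|exact: measurable_int Lim].
split => //.
have Ls := integrableD measurableT (integrable_norm Lre) (integrable_norm Lim).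
apply: (@le_lt_trans _ _
  (int (fun x : Borel G => `|complex.Re (f x)| + `|complex.Im (f x)|))%:E).
  rewrite EFin_Rintegral; last exact: Ls.
  apply: ge0_le_integral => //.
  - by move=> x _; rewrite lee_fin cabs_ge0.
  - by apply/measurable_EFinP; exact: (measurable_cabs mf).
  - exact: (measurable_int _ Ls).
  - by move=> x _; rewrite lee_fin cabs_le_ReIm.
exact: ltry.
Qed.

Lemma cint_mul_real f k : cint mu (fun x => f x * (k x)%:C%C) =
  (int (fun x : Borel G => complex.Re (f x) * k x) +i*
   int (fun x : Borel G => complex.Im (f x) * k x))%C.
Proof.
congr Complex; apply: eq_Rintegral => x _; first by rewrite complex_ReM/= mulr0 subr0.
by rewrite complex_ImM/= mulr0 add0r.
Qed.

Lemma cint_mul_Complex f (a b : G -> R) :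
  L1 (fun x => complex.Re (f x) * a x) -> L1 (fun x => complex.Im (f x) * b x) ->
  L1 (fun x => complex.Re (f x) * b x) -> L1 (fun x => complex.Im (f x) * a x) ->
  cint mu (fun x => f x * (a x +i* b x)%C) =
  ((int (fun x => complex.Re (f x) * a x) - int (fun x => complex.Im (f x) * b x)) +i*
   (int (fun x => complex.Re (f x) * b x) + int (fun x => complex.Im (f x) * a x)))%C.
Proof.
move=> Lra Lib Lrb Lia; rewrite -RintegralB// -RintegralD//.
congr Complex; apply: eq_Rintegral => x _; first by rewrite complex_ReM.
by rewrite complex_ImM.
Qed.

Lemma cint_preserving (phi : G -> G) f : preserving mu phi -> cintegrable f ->
  cint mu (fun x => f (phi x)) = cint mu f.
Proof.
move=> pphi [Lre Lim]; congr Complex.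
- exact: (Rintegral_preserving pphi Lre).
- exact: (Rintegral_preserving pphi Lim).
Qed.

Lemma cintegrable_preserving (phi : G -> G) f : preserving mu phi ->
  cintegrable f -> cintegrable (fun x => f (phi x)).
Proof.
move=> pphi [Lre Lim]; split.
- exact: (integrable_preserving pphi Lre).
- exact: (integrable_preserving pphi Lim).
Qed.

Lemma cintZr f (c : R[i]) : cintegrable f ->
  cint mu (fun x => f x * c) = cint mu f * c.
Proof.
move=> [Lre Lim]; case: c => c d.
have Z (k : Borel G -> R) r : L1 k -> L1 (fun x => k x * r).
  by move=> Lk; exact: (integrableZr measurableT r Lk).
rewrite (@cint_mul_Complex f (fun=> c) (fun=> d)) ?RintegralZr//; exact: Z.
Qed.

End ComplexIntegral.

(** * Complex convolution and its Fourier transform *)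

Section ComplexHaar.
Context {R : realType} {G : topologicalZmodType}.
Variable mu : {measure set (Borel G) -> \bar R}.
Hypothesis fin : (mu [set: Borel G] < +oo)%E.
Hypotheses (HG : hausdorff_space G) (cG : compact [set: G]).
Hypothesis Hmu : haar_measure mu.
Implicit Types (f g F : G -> R[i]) (u : G -> R).

Local Notation int f := (Rintegral mu [set: Borel G] f).
Local Notation L1 f := (mu.-integrable [set: Borel G] (EFin \o f)).
Local Notation re f := (fun x : Borel G => complex.Re (f x)).
Local Notation im f := (fun x : Borel G => complex.Im (f x)).
Local Notation toC u := (fun x : G => (u x)%:C%C).

Lemma ccontinuous_cintegrable f : ccontinuous f -> cintegrable mu f.
Proof.
by move=> [cre cim]; split;
  [exact: (continuous_integrable fin cG cre)|exact: (continuous_integrable fin cG cim)].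
Qed.

Lemma ccontinuous_cmeasurable f : ccontinuous f -> cmeasurable f.
Proof.
by move=> [cre cim]; split;
  [exact: (continuous_measurable_Borel cre)|exact: (continuous_measurable_Borel cim)].
Qed.

Lemma ccontinuous_cabs_bounded f : ccontinuous f ->
  exists2 M, 0 < M & forall x, cabs (f x) <= M.
Proof.
move=> [cre cim]; have [M M0 hM] := continuous_bounded cG cre.
have [N N0 hN] := continuous_bounded cG cim.
exists (M + N) => [|x]; first by rewrite addr_gt0.
exact: le_trans (cabs_le_ReIm _) (lerD (hM x) (hN x)).
Qed.

Lemma cintegrable_mul f g : cintegrable mu f -> ccontinuous g ->
  cintegrable mu (fun x => f x * g x).
Proof.
move=> [Lre Lim] [cre cim].
have Lm (a : Borel G -> R) (k : G -> R) : L1 a -> continuous k -> L1 (fun x => a x * k x).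
  move=> La ck; have [M _ hM] := continuous_bounded cG ck.
  exact: (integrable_mul_bounded La (continuous_measurable_Borel ck) hM).
split.
- apply: eq_integrable (integrableB measurableT (Lm _ _ Lre cre) (Lm _ _ Lim cim)) => //.
  by move=> x _; exact: (congr1 EFin (esym (complex_ReM _ _))).
- apply: eq_integrable (integrableD measurableT (Lm _ _ Lre cim) (Lm _ _ Lim cre)) => //.
  by move=> x _; exact: (congr1 EFin (esym (complex_ImM _ _))).
Qed.

Lemma ccontinuous_sub_left f (x : G) :
  ccontinuous f -> ccontinuous (fun y => f (x - y)).
Proof.
move=> [cre cim]; split => y.
- apply: (@continuous_comp _ _ _ (fun y => x - y) (fun z => complex.Re (f z))).
    exact: continuous_subl.
  exact: cre.
- apply: (@continuous_comp _ _ _ (fun y => x - y) (fun z => complex.Im (f z))).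
    exact: continuous_subl.
  exact: cim.
Qed.

Lemma ccontinuous_toC u : continuous u -> ccontinuous (toC u).
Proof. by move=> cu; split => //; exact: cst_continuous. Qed.

Lemma conv_toC f u x : Defs.conv mu f (toC u) x =
  (int (fun y => complex.Re (f y) * u (x - y)) +i*
   int (fun y => complex.Im (f y) * u (x - y)))%C.
Proof. exact: (cint_mul_real mu f (fun y => u (x - y))). Qed.

Lemma ccontinuous_conv_toC f u : cintegrable mu f -> continuous u ->
  ccontinuous (Defs.conv mu f (toC u)).
Proof.
move=> [Lre Lim] cu; split.
- have -> : (fun x : G => complex.Re (Defs.conv mu f (toC u) x)) =
      (fun x => int (fun y => complex.Re (f y) * u (x - y))).
    by apply/funext => x; rewrite conv_toC.
  exact: (continuous_convolution cG Lre cu).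
- have -> : (fun x : G => complex.Im (Defs.conv mu f (toC u) x)) =
      (fun x => int (fun y => complex.Im (f y) * u (x - y))).
    by apply/funext => x; rewrite conv_toC.
  exact: (continuous_convolution cG Lim cu).
Qed.

(** The substitution of [x - y] for [y] exchanges the factors. It lets a convolution whose
    continuous factor stands on the left be treated as one with a continuous kernel. *)
Lemma conv_flip f g x : cintegrable mu f -> ccontinuous g ->
  Defs.conv mu g f x = Defs.conv mu f g x.
Proof.
move=> Lf cg.
have Lk : cintegrable mu (fun y => f y * g (x - y)).
  exact: cintegrable_mul Lf (ccontinuous_sub_left x cg).
rewrite /Defs.conv -(cint_preserving (preserving_subl fin HG cG Hmu x) Lk).
by congr cint; apply/funext => y; rewrite subKr mulrC.
Qed.

Lemma ccontinuous_conv f g : cintegrable mu f -> ccontinuous g ->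
  ccontinuous (Defs.conv mu f g).
Proof.
move=> [Lre Lim] [cre cim].
have cv (a : Borel G -> R) (k : G -> R) : L1 a -> continuous k ->
    continuous (fun x => int (fun y => a y * k (x - y))).
  exact: continuous_convolution.
have Lm (a : Borel G -> R) (k : G -> R) x : L1 a -> continuous k ->
    L1 (fun y => a y * k (x - y)).
  move=> La ck; have [M _ hM] := continuous_bounded cG ck.
  apply: (@integrable_mul_bounded _ _ mu a _ M) => //.
  apply: (@continuous_measurable_Borel R G (fun y => k (x - y))) => y.
  by apply: continuous_comp; [exact: continuous_subl|exact: ck].
split.
- have -> : (fun x => complex.Re (Defs.conv mu f g x)) = (fun x =>
     int (fun y => complex.Re (f y) * complex.Re (g (x - y))) -
     int (fun y => complex.Im (f y) * complex.Im (g (x - y)))); last first.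
    by move=> x; exact: (@continuousB R R^o G _ _ x
      (cv _ _ Lre cre x) (cv _ _ Lim cim x)).
  apply/funext => x.
  rewrite -RintegralB//; [|exact: (Lm _ _ x Lre cre)|exact: (Lm _ _ x Lim cim)].
  by apply: eq_Rintegral => y _; rewrite complex_ReM.
- have -> : (fun x => complex.Im (Defs.conv mu f g x)) = (fun x =>
     int (fun y => complex.Re (f y) * complex.Im (g (x - y))) +
     int (fun y => complex.Im (f y) * complex.Re (g (x - y)))); last first.
    by move=> x; exact: (@continuousD R R^o G _ _ x
      (cv _ _ Lre cim x) (cv _ _ Lim cre x)).
  apply/funext => x.
  rewrite -RintegralD//; [|exact: (Lm _ _ x Lre cim)|exact: (Lm _ _ x Lim cre)].
  by apply: eq_Rintegral => y _; rewrite complex_ImM.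
Qed.

(** Both sides split into four real double integrals, one for each choice of parts of [f] and [g],
    and [Fubini_convolution] matches them. *)
Lemma cint_Fubini f g u : cintegrable mu f -> cintegrable mu g -> continuous u ->
  cint mu (fun x => g x * cint mu (fun y => f y * (u (x - y))%:C%C)) =
  cint mu (fun y => f y * cint mu (fun x => g x * (u (x - y))%:C%C)).
Proof.
move=> [fre fim] [gre gim] cu.
(* On the right-hand side the integrated variable comes first in [u (y - x)]. The reflected kernel
   turns this into [u' (x - y)], a convolution again. *)
pose u' := fun x => u (- x).
have cu' : continuous u' by exact: continuous_oppr_comp.
have Lm (a b : Borel G -> R) (k : G -> R) : continuous k -> L1 a -> L1 b ->
    L1 (fun x => b x * int (fun y => a y * k (x - y))).
  move=> ck La Lb; have cc := continuous_convolution cG La ck.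
  have [M _ hM] := continuous_bounded cG cc.
  exact: (integrable_mul_bounded Lb (continuous_measurable_Borel cc) hM).
have Lm' (a b : Borel G -> R) : L1 a -> L1 b ->
    L1 (fun x => b x * int (fun y => a y * u (y - x))).
  move=> La Lb; rewrite (_ : (fun x => _) =
    (fun x => b x * int (fun y => a y * u' (x - y)))); first exact: Lm.
  apply/funext => x; congr (_ * _); apply: eq_Rintegral => y _.
  by rewrite /u' opprB.
have FF a b : L1 a -> L1 b -> _ := @Fubini_convolution _ _ mu fin cG a b u cu.
transitivity (cint mu (fun x => g x *
    (int (fun y => complex.Re (f y) * u (x - y)) +i*
     int (fun y => complex.Im (f y) * u (x - y)))%C)).
  congr cint; apply/funext => x; congr (_ * _).
  exact: (cint_mul_real mu f (fun y => u (x - y))).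
transitivity (cint mu (fun y => f y *
    (int (fun x => complex.Re (g x) * u (x - y)) +i*
     int (fun x => complex.Im (g x) * u (x - y)))%C)); last first.
  congr cint; apply/funext => y; congr (_ * _).
  exact/esym/(cint_mul_real mu g (fun x => u (x - y))).
apply: etrans (cint_mul_Complex (Lm _ _ _ cu fre gre) (Lm _ _ _ cu fim gim)
  (Lm _ _ _ cu fim gre) (Lm _ _ _ cu fre gim)) _.
apply: etrans _ (esym (cint_mul_Complex (Lm' _ _ gre fre) (Lm' _ _ gim fim)
  (Lm' _ _ gim fre) (Lm' _ _ gre fim))).
have Frr := FF _ _ fre gre; have Fii := FF _ _ fim gim.
have Fri := FF _ _ fre gim; have Fir := FF _ _ fim gre.
apply: (congr2 (@Complex _)).
  apply: (congr2 +%R); first exact: Frr.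
  by apply: (congr1 -%R); exact: Fii.
by apply: etrans (addrC _ _) _; apply: (congr2 +%R); [exact: Fri|exact: Fir].
Qed.

(** This moves the smoothing factor from [f] to [F]. After Fubini, the inner integral of [F (x - w)]
    against [u (w - y)] becomes, under the substitution of [x - w] for [w], the value of [F * u] at
    [x - y]. *)
Lemma convA_toC f F u x : cintegrable mu f -> cintegrable mu F -> continuous u ->
  Defs.conv mu (Defs.conv mu f (toC u)) F x = Defs.conv mu f (Defs.conv mu F (toC u)) x.
Proof.
move=> Lf LF cu; have px := preserving_subl fin HG cG Hmu x.
have LFx := cintegrable_preserving px LF.
transitivity (cint mu (fun w => F (x - w) * Defs.conv mu f (toC u) w)).
  by congr cint; apply/funext => w; rewrite mulrC.
rewrite (cint_Fubini Lf LFx cu); congr cint; apply/funext => y; congr (_ * _).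
have Lk : cintegrable mu (fun z => F z * (u (x - y - z))%:C%C).
  apply: cintegrable_mul => //.
  exact: (ccontinuous_sub_left (x - y) (ccontinuous_toC cu)).
rewrite /Defs.conv -(cint_preserving px Lk); congr cint; apply/funext => w.
by congr (_ * (u _)%:C%C); rewrite opprB [_ + (w - x)]addrC addrA subrK.
Qed.

Lemma ccontinuous_cconj_character (chi : G -> R[i]) : character chi ->
  ccontinuous (fun x => cconj (chi x)).
Proof.
move=> [_ _ cchi]; split => x; apply/cvgrPdist_lt => e e0.
- have := cchi x e e0; apply: filterS => y; apply: le_lt_trans.
  by rewrite distrC; have := Re_le_cabs (chi y - chi x); rewrite complex_ReB.
- have := cchi x e e0; apply: filterS => y; apply: le_lt_trans.
  by rewrite /= opprK addrC; have := Im_le_cabs (chi y - chi x); rewrite complex_ImB.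
Qed.

Lemma cconjM (x y : R[i]) : cconj (x * y) = cconj x * cconj y.
Proof. by case: x y => [a b] [c d]; rewrite /cconj; simpc; congr Complex; ring. Qed.

(** After Fubini, the inner integral of the conjugate character against [u (x - y)] is translated by
    [y]. Multiplicativity of [chi] then splits off the factor [cconj (chi y)]. *)
Lemma fourier_conv_toC f u chi : cintegrable mu f -> continuous u ->
  character chi ->
  fourier mu (Defs.conv mu f (toC u)) chi = fourier mu f chi * fourier mu (toC u) chi.
Proof.
move=> Lf cu hchi; have [chiD _ _] := hchi.
have cchi := ccontinuous_cconj_character hchi.
have Lchi := ccontinuous_cintegrable cchi.
transitivity (cint mu (fun x => cconj (chi x) * Defs.conv mu f (toC u) x)).
  by congr cint; apply/funext => w; rewrite mulrC.
rewrite (cint_Fubini Lf Lchi cu).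
rewrite /fourier -cintZr; last exact: cintegrable_mul.
congr cint; apply/funext => y; rewrite -mulrA; congr (_ * _).
have Lk : cintegrable mu (fun z => (toC u) z * cconj (chi z)).
  by apply: cintegrable_mul => //; exact/ccontinuous_cintegrable/ccontinuous_toC.
rewrite mulrC -cintZr//.
have Lk' : cintegrable mu (fun z => (toC u) z * cconj (chi z) * cconj (chi y)).
  by apply: cintegrable_mul => //; split; exact: cst_continuous.
rewrite -(cint_preserving (preserving_subr Hmu y) Lk').
congr cint; apply/funext => z.
by rewrite -mulrA -cconjM -chiD subrK mulrC.
Qed.

End ComplexHaar.

(** * Comparison of the grand Lebesgue norm with the [L1] and uniform norms *)

Section GrandLebesgue.
Context {R : realType} {G : topologicalZmodType}.
Variable mu : {measure set (Borel G) -> \bar R}.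
Variables p theta : R.
Hypothesis p1 : 1 < p.
Implicit Types f : G -> R[i].

(* The term [eps = p - 1] of the supremum is a multiple of the [L1] norm. *)
Lemma L1norm_le_grand_norm f :
  (((p - 1) `^ theta)%:E * L1norm mu f <= grand_norm mu p theta f)%E.
Proof.
apply: ereal_sup_ubound; exists (p - 1).
  by rewrite /= in_itv/= lexx subr_gt0 p1.
rewrite subKr divr1 invr1 poweRe1; last first.
  by apply: integral_ge0 => x _; rewrite lee_fin powR_ge0.
congr (_ * _)%E; apply: eq_integral => x _.
by rewrite powRr1// cabs_ge0.
Qed.

Lemma grand_weight_gt0 : 0 < (p - 1) `^ theta.
Proof. by rewrite powR_gt0// subr_gt0. Qed.

Lemma in_grand_inL1 f : in_grand mu p theta f -> inL1 mu f.
Proof.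
move=> [mf foo]; split => //; have w0 := grand_weight_gt0.
rewrite ltNge; apply/negP; rewrite leye_eq => /eqP f1.
have := le_lt_trans (L1norm_le_grand_norm f) foo.
by rewrite f1 gt0_muley ?lte_fin// ltxx.
Qed.

(** The exponent [p - eps] is at least 1 throughout the supremum, so every term obeys the same bound
    [p ^ theta * (N * m)]. *)
Lemma bounded_in_grand (fin : (mu [set: Borel G] < +oo)%E) f (M : R) :
  0 <= theta -> cmeasurable f -> (forall x, cabs (f x) <= M) ->
  in_grand mu p theta f.
Proof.
move=> theta0 mf fM; split => //.
(* The added 1 gives [m >= 1], hence [m <= m ^ (p - eps)]. The maximum with 1 makes [N] a positive
   bound even if [M] is negative. *)
pose m := fine (mu [set: Borel G]) + 1; pose N := Num.max M 1.
have m1 : 1 <= m by rewrite lerDr fine_ge0.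
have N1 : 1 <= N by rewrite le_max lexx orbT.
have fN x : cabs (f x) <= N by rewrite (le_trans (fM x))// le_max lexx.
apply: (@le_lt_trans _ _ (p `^ theta * (N * m))%:E); last exact: ltry.
apply: ge_ereal_sup => _ [eps /= + <-]; rewrite in_itv/= => /andP[eps0 epsp].
have q1 : 1 <= p - eps by move: epsp; lra.
have q0 : 0 < p - eps by move: q1; lra.
rewrite EFinM; apply: lee_pmul; rewrite ?lee_fin ?powR_ge0 ?poweR_ge0//.
  (* The weight is raised twice: its base from [eps] to [p], then its exponent from
     [theta / (p - eps)] to [theta], as [p > 1]. *)
  have eps_p : eps <= p by move: epsp; lra.
  apply: (@le_trans _ _ (p `^ (theta / (p - eps)))).
    by rewrite ge0_ler_powR ?nnegrE ?divr_ge0//; lra.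
  apply: ler_powR; first exact: ltW.
  by rewrite ler_piMr// invf_le1.
have Nm : N * m = ((N * m) `^ (p - eps)) `^ (p - eps)^-1.
  by rewrite -powRrM mulfV ?gt_eqF// powRr1// mulr_ge0//; lra.
rewrite [in leRHS]Nm -poweR_EFin.
have qi0 : 0 <= (p - eps)^-1 by rewrite invr_ge0 ltW.
apply: (gt0_ler_poweR qi0).
- rewrite in_itv/= leey andbT.
  by apply: integral_ge0 => x _; rewrite lee_fin powR_ge0.
- by rewrite in_itv/= leey andbT lee_fin powR_ge0.
apply: (@le_trans _ _ (\int[mu]_(x in [set: Borel G]) (N `^ (p - eps))%:E)%E).
  apply: ge0_le_integral => //.
  - by move=> x _; rewrite lee_fin powR_ge0.
  - apply/measurable_EFinP.
    apply: (@measurableT_comp _ _ _ _ _ _ (fun t : R => t `^ (p - eps))).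
      exact: measurable_powR.
    exact: measurable_cabs.
  - move=> x _; rewrite lee_fin ge0_ler_powR ?nnegrE ?cabs_ge0//; first lra.
    lra.
rewrite integral_cst//= -[mu _]fineK; last by rewrite ge0_fin_numE.
rewrite -EFinM lee_fin powRM; [|lra|lra].
rewrite ler_wpM2l ?powR_ge0//; apply: le_trans (le1r_powR m1 q1).
by rewrite /m lerDl.
Qed.

End GrandLebesgue.

(** * Transfer of the Ditkin condition from the grand Lebesgue space to [L1] *)

Theorem theorem3p1 (R : realType) (G : topologicalZmodType)
  (mu : {measure set (Borel G) -> \bar R})
  (HG : hausdorff_space G) (lcG : locally_compact [set: G])
  (Hmu : haar_measure mu) (fin : (mu [set: Borel G] < +oo)%E)
  (p theta : R) (hp : 1 < p) (htheta : 0 <= theta)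
  (E : set (G -> R[i])) (hE : dual_closed E)
  (hD : ditkin_set mu (in_grand mu p theta) (grand_norm mu p theta) E) :
  ditkin_set mu (inL1 mu) (L1norm mu) E.
Proof.
have cG := finite_haar_compact lcG Hmu fin.
move=> f fL1 fE eps eps0.
have Lf := (inL1_cintegrable mu f).1 fL1; have [fre fim] := Lf.
(* Three errors arise: the real part of [f - h], its imaginary part, and [h - h * F]. Quarters leave
   room for the strict inequality at the end. *)
have e40 : 0 < eps / 4 by rewrite divr_gt0.
have eps34 : eps / 4 + eps / 4 + eps / 4 < eps by lra.
have [V1 [oV1 V10 hV1]] := approximate_identity fin HG cG Hmu fre e40.
have [V2 [oV2 V20 hV2]] := approximate_identity fin HG cG Hmu fim e40.
have [u [cu u0 uV intu]] :=
  bump_function fin HG cG Hmu (openI oV1 oV2) (conj V10 V20).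
have {}hV1 := hV1 u cu u0 (fun x nV => uV x (fun Vx => nV Vx.1)) intu.
have {}hV2 := hV2 u cu u0 (fun x nV => uV x (fun Vx => nV Vx.2)) intu.
pose uC x := (u x)%:C%C.
pose h := Defs.conv mu f uC.
have ch : ccontinuous h := ccontinuous_conv_toC cG Lf cu.
have Lh := ccontinuous_cintegrable fin cG ch.
have [M _ hM] := ccontinuous_cabs_bounded cG ch.
have hX : in_grand mu p theta h.
  exact: (bounded_in_grand hp fin htheta (ccontinuous_cmeasurable ch) hM).
have hE0 chi : E chi -> fourier mu h chi = 0.
  move=> Echi; rewrite (fourier_conv_toC fin cG Hmu Lf cu (hE.1 chi Echi)).
  by rewrite fE// mul0r.
have w0 := grand_weight_gt0 theta hp.
(* The tolerance carries the weight of the [L1] term in the grand norm, so that dividing by it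
   leaves [eps / 4]. *)
have d0 : 0 < (p - 1) `^ theta * (eps / 4) by rewrite mulr_gt0.
have [F [FX [U [oU EU FU]] hF]] := hD h hX hE0 _ d0.
have LF := (inL1_cintegrable mu F).1 (in_grand_inL1 hp FX).
pose F' := Defs.conv mu F uC.
have cF' : ccontinuous F' := ccontinuous_conv_toC cG LF cu.
exists F'; split.
- exact/inL1_cintegrable/ccontinuous_cintegrable.
(* The same neighbourhood [U] works: the transform of [F'] is that of [F] times that of [u]. *)
- exists U; split => // chi Uchi.
  have hchi : character chi by exact: oU.1.
  by rewrite (fourier_conv_toC fin cG Hmu LF cu hchi) FU// mul0r.
have hF1 : (L1norm mu (fun x => h x - Defs.conv mu h F x)%R <= (eps / 4)%:E)%E.
  rewrite -(@lee_pmul2l _ ((p - 1) `^ theta)%:E) ?lte_fin//.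
  exact: le_trans (L1norm_le_grand_norm mu theta hp _) (ltW hF).
have chF : ccontinuous (Defs.conv mu h F).
  have -> : Defs.conv mu h F = Defs.conv mu F h.
    by apply/funext => x; exact: (conv_flip fin HG cG Hmu x LF ch).
  exact: (ccontinuous_conv cG LF ch).
pose k x := h x - Defs.conv mu h F x.
have ck : ccontinuous k.
  have [[hre him] [cre cim]] := (ch, chF).
  split => x.
  - under eq_fun do rewrite complex_ReB.
    exact: (@continuousB R R^o G _ _ x (hre x) (cre x)).
  - under eq_fun do rewrite complex_ImB.
    exact: (@continuousB R R^o G _ _ x (him x) (cim x)).
have [hre him] := Lh.
pose A x := `|complex.Re (f x) - complex.Re (h x)|.
pose B x := `|complex.Im (f x) - complex.Im (h x)|.
have LA : mu.-integrable [set: Borel G] (EFin \o A).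
  exact: (integrable_norm (integrableB measurableT fre hre)).
have LB : mu.-integrable [set: Borel G] (EFin \o B).
  exact: (integrable_norm (integrableB measurableT fim him)).
have Lk : mu.-integrable [set: Borel G] (EFin \o (fun x => cabs (k x))).
  have kL1 := (inL1_cintegrable mu k).2 (ccontinuous_cintegrable fin cG ck).
  apply/integrableP; split.
    by apply/measurable_EFinP; exact: (measurable_cabs kL1.1).
  by under eq_integral do rewrite /= ger0_norm ?cabs_ge0//; exact: kL1.2.
have LAB := integrableD measurableT LA LB.
(* As [f * F' = h * F], the difference [f - f * F'] equals [(f - h) + (h - h * F)]. *)
have pointwise x : cabs (f x - Defs.conv mu f F' x) <= A x + B x + cabs (k x).
  rewrite -(convA_toC fin HG cG Hmu x Lf LF cu).
  rewrite [X in cabs X](_ : _ = (f x - h x) + k x); last by rewrite addrA subrK.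
  rewrite (le_trans (cabsD _ _))// lerD2r (le_trans (cabs_le_ReIm _))//.
  by rewrite complex_ReB complex_ImB.
have intA : Rintegral mu [set: Borel G] A <= eps / 4.
  have -> : A = (fun x => `|complex.Re (f x) -
      Rintegral mu [set: Borel G] (fun y => complex.Re (f y) * u (x - y))|).
    by apply/funext => x; rewrite /A /h conv_toC.
  exact: hV1.
have intB : Rintegral mu [set: Borel G] B <= eps / 4.
  have -> : B = (fun x => `|complex.Im (f x) -
      Rintegral mu [set: Borel G] (fun y => complex.Im (f y) * u (x - y))|).
    by apply/funext => x; rewrite /B /h conv_toC.
  exact: hV2.
have intk : Rintegral mu [set: Borel G] (fun x => cabs (k x)) <= eps / 4.
  by rewrite -lee_fin EFin_Rintegral.
have mdiff : cmeasurable (fun x => f x - Defs.conv mu f F' x).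
  have [mre mim] := fL1.1.
  have [cre cim] : ccontinuous (Defs.conv mu f F').
    exact: (ccontinuous_conv cG Lf cF').
  split.
  - under eq_fun do rewrite complex_ReB.
    by apply: measurable_funB => //; exact: (continuous_measurable_Borel cre).
  - under eq_fun do rewrite complex_ImB.
    by apply: measurable_funB => //; exact: (continuous_measurable_Borel cim).
apply: (@le_lt_trans _ _
    (Rintegral mu [set: Borel G] (fun x => A x + B x + cabs (k x)))%:E).
  rewrite EFin_Rintegral; last exact: (integrableD measurableT LAB Lk).
  apply: ge0_le_integral => //.
  - by move=> x _; rewrite lee_fin cabs_ge0.
  - by apply/measurable_EFinP; exact: measurable_cabs.
  - exact: (measurable_int mu (integrableD measurableT LAB Lk)).
  - by move=> x _; rewrite lee_fin pointwise.
rewrite lte_fin RintegralD// RintegralD//.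
exact: le_lt_trans (lerD (lerD intA intB) intk) eps34.
Qed.
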